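(* Let $n\ge 1$ and let $f,g\in O(n+1)\cong \mathbf I(\mathbb S^n)$. Then $\tilde\sigma_f=\tilde\sigma_g$ if and only if $f$ and $g$ have the same $O(n+1)$-orbit type, i.e. if and only if their centralizers $O(n+1)_f=\{h\in O(n+1): hf=fh\}$ and $O(n+1)_g$ are conjugate subgroups of $O(n+1)$.
   Context: The isometry group of the unit sphere $\mathbb S^n\subset\mathbb R^{n+1}$ is identified with $O(n+1)$, acting on itself by conjugation; two elements of a group have the same orbit type iff their isotropy groups (centralizers) are conjugate. Segre symbol of an orthogonal map: for $A\in O(m)$, $\tilde\sigma_A$ consists of (a) the multiset $\{n_1,\dots,n_s\}$ where $\{\lambda_1,\bar\lambda_1\},\dots,\{\lambda_s,\bar\lambda_s\}$ are the distinct pairs of non-real complex eigenvalues of $A$ and $n_i=\dim_{\mathbb C}\ker(A-\lambda_i)$, and (b) the multiset $\{m_1,m_2\}$ (possibly with fewer than two entries) of the numbers $\dim\ker(A-\varepsilon)$ for those $\varepsilon\in\{1,-1\}$ that are eigenvalues of $A$. It is written $[(n_1\bar n_1),\dots,(n_s\bar n_s),m_1,m_2]$ with $n_1\ge\dots\ge n_s$, $m_1\ge m_2$. Note that whether a given $m_i$ comes from eigenvalue $1$ or $-1$ is not recorded. *)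

(* Defs.v *)
From HB Require Import structures.
From mathcomp Require Import all_boot all_order all_algebra.
Set Implicit Arguments. Unset Strict Implicit. Unset Printing Implicit Defensive.
Import Order.TTheory GRing.Theory Num.Theory.
Local Open Scope ring_scope.

(* C is a numeric algebraically closed field (the role of the complex numbers);
   its real elements (Num.real) play the role of the real numbers.
   Real m x m matrices are matrices over C with all entries in Num.real. *)

Section Defs.
Variable C : numClosedFieldType.

Definition orth_mx (m : nat) (A : 'M[C]_m) : Prop :=
  A \is a mxOver Num.real /\ A *m A^T = 1%:M.

Definition dimker (m : nat) (M : 'M[C]_m) : nat := \rank (kermx M).

Definition eigvals (m : nat) (A : 'M[C]_m) : seq C :=
  undup (sval (closed_field_poly_normal (char_poly A))).

(* (a) multiset {n_1,...,n_s}: one representative lambda_i per pair of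
   non-real conjugate eigenvalues (the one with positive imaginary part),
   n_i = dim_C ker(A - lambda_i); listed in non-increasing order. *)
Definition segre_pairs (m : nat) (A : 'M[C]_m) : seq nat :=
  sort geq [seq dimker (A - lam%:M) | lam <- eigvals A & 0 < 'Im lam].

(* (b) multiset {m_1, m_2} of dim ker(A - eps) for eps in {1,-1} that are
   eigenvalues of A, listed in non-increasing order. *)
Definition segre_real (m : nat) (A : 'M[C]_m) : seq nat :=
  sort geq [seq k <- [:: dimker (A - 1%:M); dimker (A + 1%:M)] | (0 < k)%N].

Definition segre (m : nat) (A : 'M[C]_m) : seq nat * seq nat :=
  (segre_pairs A, segre_real A).

Definition centralizer_O (m : nat) (f : 'M[C]_m) (h : 'M[C]_m) : Prop :=
  orth_mx h /\ h *m f = f *m h.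

Definition conjugate_in_O (m : nat) (H K : 'M[C]_m -> Prop) : Prop :=
  exists k : 'M[C]_m, orth_mx k /\
    forall h : 'M[C]_m, K h <-> exists2 h0, H h0 & h = k *m h0 *m invmx k.

End Defs.

(* Main.v *)
Require Import Defs.
From HB Require Import structures.
From mathcomp Require Import all_boot all_order all_algebra all_fingroup.
Import Order.TTheory GRing.Theory Num.Theory.
Local Open Scope ring_scope.

(** An orthogonal map is unitarily diagonalizable, and its Segre symbol only
depends on the spectrum, counted with multiplicity.  Two symbols agree iff some
map phi between the spectra is injective, commutes with complex conjugation and
preserves multiplicities.

Given phi, a real polynomial p interpolating phi turns f into an orthogonal map
p(f) with the same centralizer and the same spectrum as g.  Then p(f) and g are
similar, hence similar over the reals, hence orthogonally similar by polar
decomposition.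

Conversely, after conjugation f and g have the same centralizer in the
orthogonal group.  This centralizer determines the full complex commutant: a
real symmetric matrix is a combination of reflections, and an antisymmetric one
is recovered from its Cayley transform.  So f and g have the same commutant,
hence are simultaneously diagonalizable with the same coincidences between
eigenvalues, and phi matches the eigenvalues on common eigenvectors; it commutes
with conjugation because g is both p(f) and its conjugate, for any p
interpolating phi. *)

Set Implicit Arguments.
Unset Strict Implicit.
Unset Printing Implicit Defensive.
Local Open Scope sesquilinear_scope.
Local Notation conjC := Num.Def.conjC.

(** * Matching spectra *)

Section SeqMatching.
Variable T : eqType.
Implicit Types (s t : seq T).

(** The counts make [s] a permutation of the part of [t] lying in [s]; equality of sizes then leaves
    no room in [t] for anything else. *)
Lemma perm_eq_count_in s t :
  size s = size t -> {in s, forall x, count_mem x s = count_mem x t} ->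
  perm_eq s t.
Proof.
move=> eq_sz eq_cnt.
have perm_s : perm_eq s (filter (mem s) t).
  apply/allP => x _ /=; apply/eqP.
  rewrite count_filter; case xs: (x \in s).
    rewrite eq_cnt //; apply: eq_count => y /=.
    by case: eqP => //= ->; rewrite xs.
  rewrite (count_memPn (negbT xs)); symmetry; apply/eqP.
  rewrite eqn0Ngt -has_count; apply/hasPn => y _ /=.
  by case: eqP => //= ->; rewrite xs.
have : all (mem s) t by rewrite all_count -size_filter -(perm_size perm_s) eq_sz.
by move=> /all_filterP eq_t; rewrite -[t]eq_t.
Qed.

(** Reorder [t] so that its [d]-labels agree position by position with the [c]-labels of [s]; [psi]
    sends an element of [s] to the entry at the same position. *)
Lemma perm_map_matching (R : eqType) (c d : T -> R) s t :
  uniq s -> uniq t -> perm_eq (map c s) (map d t) ->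
  exists psi : T -> T,
    [/\ {in s &, injective psi}, {in s, forall x, psi x \in t}
      & {in s, forall x, d (psi x) = c x}].
Proof.
case: s => [|x0 s0]; first by exists id.
set s := x0 :: s0; move=> uniq_s uniq_t.
case/(perm_iotaP (c x0)) => I permI eq_cs.
rewrite size_map in permI.
pose t' := map (nth x0 t) I.
have perm_t : perm_eq t' t.
  rewrite /t' (perm_trans (perm_map _ permI)) // -/(mkseq _ _) mkseq_nth.
  exact: perm_refl.
have eq_cd : map c s = map d t'.
  rewrite eq_cs -map_comp; apply/eq_in_map => i.
  rewrite (perm_mem permI) mem_iota add0n => lt_it /=.
  by rewrite (nth_map x0).
have sz : size s = size t' by rewrite -(size_map c) eq_cd size_map.
have idx x : x \in s -> (index x s < size t')%N by rewrite -sz index_mem.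
exists (fun x => nth x0 t' (index x s)); split => [x y xs ys eq_xy|x xs|x xs].
- apply: (index_inj x0 xs) => //; apply/eqP.
  by rewrite -(nth_uniq x0 (idx x xs) (idx y ys)) ?eq_xy // (perm_uniq perm_t).
- by rewrite -(perm_mem perm_t) mem_nth ?idx.
- rewrite -(nth_map x0 (c x0)) ?idx // -eq_cd (nth_map x0) ?index_mem //.
  by rewrite nth_index.
Qed.

End SeqMatching.

(** * Conjugation-equivariant matchings versus multiplicities of conjugate pairs and of real
    eigenvalues *)

Section SpectrumMatching.
Variable C : numClosedFieldType.
Implicit Types (s t : seq C) (x y : C) (phi : C -> C).

Definition upper s := [seq x <- undup s | 0 < 'Im x].
(** The candidates [1] and [-1] come in the order used by [segre_real]. *)
Definition signs s : seq C := [seq e <- [:: 1; -1] | e \in s].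

(** Lists carry multiplicities, so the permutation condition together with injectivity on [s] says
    that [phi] preserves them. Values of [phi] outside [s] are irrelevant. *)
Definition spectral_matching s t phi :=
  [/\ {in s &, injective phi}, {in s, forall x, phi x^* = (phi x)^*}
    & perm_eq (map phi s) t].

Lemma conj_Im0 x : ('Im x == 0) = (x^* == x).
Proof. by rewrite -CrealE; apply/eqP/idP => /Creal_ImP. Qed.

Lemma unit_real x : x * x^* = 1 -> x^* = x -> x \in [:: 1; -1].
Proof.
move=> xx1 xr; rewrite xr in xx1; rewrite !inE -sqrf_eq1 expr2 xx1.
exact: eqxx.
Qed.

Section Pair.
Variables s t : seq C.
Hypothesis cjs : forall x, count_mem x^* s = count_mem x s.
Hypothesis cjt : forall x, count_mem x^* t = count_mem x t.
Hypothesis ns : {in s, forall x, x * x^* = 1}.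
Hypothesis nt : {in t, forall x, x * x^* = 1}.

Let mem_conj u : (forall x, count_mem x^* u = count_mem x u) ->
  forall x, (x^* \in u) = (x \in u).
Proof. by move=> h x; rewrite -!has_pred1 !has_count h. Qed.

(** Points of the upper half-plane are matched by equal multiplicity, their conjugates by symmetry,
    and [1], [-1] separately; the norm condition leaves no other real points. *)
Lemma matching_of_counts : size s = size t ->
  perm_eq [seq count_mem x s | x <- upper s] [seq count_mem x t | x <- upper t] ->
  perm_eq [seq count_mem x s | x <- signs s] [seq count_mem x t | x <- signs t] ->
  exists phi, spectral_matching s t phi.
Proof.
have ms := mem_conj cjs; have mt := mem_conj cjt.
move=> eq_sz permU permR.
have uU u : uniq (upper u) by rewrite filter_uniq ?undup_uniq.
have uR u : uniq (signs u).
  rewrite filter_uniq //= !inE andbT -subr_eq0 opprK.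
  by rewrite -mulr2n pnatr_eq0.
have [pu [injU memU cntU]] := perm_map_matching (uU s) (uU t) permU.
have [pr [injR memR cntR]] := perm_map_matching (uR s) (uR t) permR.
pose phi x := if 0 < 'Im x then pu x else if 'Im x < 0 then (pu x^*)^* else pr x.
have Im_real x : 'Im x \is Num.real := Creal_Im x.
have split_s x : x \in s ->
  [\/ x \in upper s /\ phi x = pu x, x^* \in upper s /\ phi x = (pu x^*)^*
    | x \in signs s /\ phi x = pr x].
  move=> xs; rewrite /phi !mem_filter !mem_undup ms xs !andbT Im_conj oppr_gt0.
  case: (real_ltgtP (real0 _) (Im_real x)) => [lt|lt|eq0]; first by constructor 1.
    by constructor 2.
  constructor 3; split=> //; apply: unit_real; first exact: ns.
  by apply/eqP; rewrite -conj_Im0 -eq0.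
have ImU x u : x \in upper u -> 0 < 'Im x by rewrite mem_filter => /andP[].
have ImR x u : x \in signs u -> 'Im x = 0.
  rewrite mem_filter => /andP[_]; rewrite !inE => /orP[]/eqP->.
    exact/Creal_ImP/real1.
  by apply/Creal_ImP; rewrite realN real1.
have cphi x : x \in s -> phi x^* = (phi x)^*.
  move=> xs; rewrite /phi Im_conj oppr_gt0 oppr_lt0 conjCK.
  case: (real_ltgtP (real0 _) (Im_real x)) => [//|lt|eq0]; first by rewrite conjCK.
  have xr : x^* = x by apply/eqP; rewrite -conj_Im0 -eq0.
  have xR : x \in signs s by rewrite mem_filter xs unit_real ?ns.
  by rewrite xr; apply/esym/eqP; rewrite -conj_Im0 (ImR _ t) ?memR.
have cnt x : x \in s -> count_mem (phi x) t = count_mem x s.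
  case/split_s => -[xU ->]; first exact: cntU; last exact: cntR.
  by rewrite cjt cntU ?cjs.
have inj : {in s &, injective phi}.
  have iU x : x \in upper s -> 0 < 'Im (pu x) by move=> /memU/ImU.
  have iR x : x \in signs s -> 'Im (pr x) = 0 by move=> /memR/ImR.
  have ltN (a : C) : 0 < 'Im a -> 0 < 'Im a^* -> False.
    by rewrite Im_conj oppr_gt0 => /lt_trans h /h; rewrite ltxx.
  (* Nine cases, by the signs of the imaginary parts of [x] and [y]. In the mixed ones the images
     have imaginary parts of different sign. *)
  move=> x y /split_s[] [xU ->] /split_s[] [yU ->] eq_xy.
  - exact: injU.
  - by case: (ltN _ (iU _ yU)); rewrite -eq_xy iU.
  - by have := iU x xU; rewrite eq_xy iR ?ltxx.
  - by case: (ltN _ (iU _ xU)); rewrite eq_xy iU.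
  - by apply: (can_inj conjCK); apply: injU => //; apply: (can_inj conjCK).
  - by have := iU _ xU; rewrite -oppr_lt0 -Im_conj eq_xy iR ?ltxx.
  - by have := iU y yU; rewrite -eq_xy iR ?ltxx.
  - by have := iU _ yU; rewrite -oppr_lt0 -Im_conj -eq_xy iR ?ltxx.
  - exact: injR.
exists phi; split=> //; apply: perm_eq_count_in; first by rewrite size_map.
move=> _ /mapP[x xs ->]; rewrite cnt // count_map.
apply: eq_in_count => y ys /=.
by apply/eqP/eqP => [/inj->|->].
Qed.

(** A matching may send the upper half-plane partly into the lower one; replacing such images by
    their conjugates repairs this without changing multiplicities. *)
Lemma counts_of_matching phi : spectral_matching s t phi ->
  perm_eq [seq count_mem x s | x <- upper s] [seq count_mem x t | x <- upper t] /\
  perm_eq [seq count_mem x s | x <- signs s] [seq count_mem x t | x <- signs t].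
Proof.
have ms := mem_conj cjs; have mt := mem_conj cjt.
case=> inj cj perm_t.
have cnt x : x \in s -> count_mem (phi x) t = count_mem x s.
  move=> xs; rewrite -(seq.permP perm_t) count_map.
  by apply: eq_in_count => y ys /=; apply/eqP/eqP => [/inj->|->].
have memt x : x \in s -> phi x \in t.
  by move=> xs; rewrite -(perm_mem perm_t) map_f.
have imt y : y \in t -> exists2 x, x \in s & y = phi x.
  by rewrite -(perm_mem perm_t) => /mapP.
(* Equivariance preserves real points, and injectivity on [s] reflects them. *)
have real_phi x : x \in s -> (phi x)^* = phi x <-> x^* = x.
  move=> xs; rewrite -cj //; split => [|->//]; apply: inj => //.
  by rewrite ms.
pose psi x := if 0 < 'Im (phi x) then phi x else (phi x)^*.
split.
  have cpsi x : x \in s -> count_mem (psi x) t = count_mem x s.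
    by move=> xs; rewrite /psi; case: ifP => _; rewrite ?cjt cnt.
  have perm_psi : perm_eq (map psi (upper s)) (upper t).
    apply: uniq_perm; last 1 first.
    - move=> z; apply/mapP/idP => [[x]|].
        rewrite mem_filter mem_undup => /andP[Ix xs] ->.
        rewrite mem_filter mem_undup /psi.
        case: (real_ltgtP (real0 _) (Creal_Im (phi x))) => [lt|lt|/esym/eqP].
        + by rewrite lt memt.
        + by rewrite Im_conj oppr_gt0 lt mt memt.
        + rewrite conj_Im0 => /eqP/(real_phi x xs)/eqP.
          by rewrite -conj_Im0 gt_eqF.
      rewrite mem_filter mem_undup => /andP[Iz /imt[x xs def_z]].
      case: (real_ltgtP (real0 _) (Creal_Im x)) => [lt|lt|/esym/eqP].
      + by exists x; rewrite ?mem_filter ?mem_undup ?lt // /psi -def_z Iz.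
      + exists x^*; first by rewrite mem_filter mem_undup Im_conj oppr_gt0 lt ms.
        rewrite /psi cj // -def_z Im_conj oppr_gt0 conjCK.
        by rewrite (lt_gtF Iz).
      + rewrite conj_Im0 => /eqP/(real_phi x xs); rewrite -def_z => /eqP.
        by rewrite -conj_Im0 gt_eqF.
    - rewrite map_inj_in_uniq ?filter_uniq ?undup_uniq //.
      move=> x y; rewrite !mem_filter !mem_undup => /andP[Ix xs] /andP[Iy ys].
      have no (a b : C) : 0 < 'Im a -> 0 < 'Im b -> a = b^* -> False.
        move=> Ia Ib eq_ab; move: Ia; rewrite eq_ab Im_conj oppr_gt0.
        by rewrite (lt_gtF Ib).
      rewrite /psi; case: ifP => _; case: ifP => _; rewrite -?cj //.
      + exact: inj.
      + by move=> eq_xy; case: (no x y) => //; apply: inj; rewrite ?ms.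
      + by move=> eq_xy; case: (no y x) => //; apply: inj; rewrite ?ms.
      + move=> /inj; rewrite !ms => /(_ xs ys)/(can_inj conjCK) //.
    - by rewrite filter_uniq ?undup_uniq.
  rewrite perm_sym -(permPl (perm_map _ perm_psi)) -map_comp.
  apply/seq.permP => a; congr (count a _); apply/eq_in_map => x /=.
  by rewrite mem_filter mem_undup => /andP[_ /cpsi].
have uR u : uniq (signs u).
  rewrite filter_uniq //= !inE andbT -subr_eq0 opprK.
  by rewrite -mulr2n pnatr_eq0.
have signs_real u x : x \in signs u -> x^* = x.
  by rewrite mem_filter !inE => /andP[_ /orP[]/eqP->]; rewrite ?rmorphN rmorph1.
have perm_phi : perm_eq (map phi (signs s)) (signs t).
  apply: uniq_perm => //.
    rewrite map_inj_in_uniq // => x y; rewrite !mem_filter.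
    by move=> /andP[xs _] /andP[ys _]; apply: inj.
  move=> z; apply/mapP/idP => [[x xR ->]|zR].
    move: (xR); rewrite !mem_filter => /andP[xs _]; rewrite memt //=.
    apply: unit_real; first by rewrite nt ?memt.
    exact/(real_phi x xs)/(signs_real s).
  move: (zR); rewrite mem_filter => /andP[/imt[x xs def_z] _].
  exists x => //; rewrite mem_filter xs unit_real ?ns //.
  by apply/(real_phi x xs); rewrite -def_z; apply: signs_real zR.
rewrite perm_sym -(permPl (perm_map _ perm_phi)) -map_comp.
apply/seq.permP => a; congr (count a _); apply/eq_in_map => x /=.
by rewrite mem_filter => /andP[xs _]; rewrite cnt.
Qed.

End Pair.
End SpectrumMatching.

(** * Unitary diagonalization *)

Section Interpolation.

(** Newton interpolation: to reach a new point [a], add a multiple of [w], which vanishes on [s] but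
    not at [a]. *)
Lemma poly_interpolation (F : fieldType) (s : seq F) (phi : F -> F) :
  exists p : {poly F}, {in s, forall x, p.[x] = phi x}.
Proof.
elim: s => [|a s [p ps]]; first by exists 0.
have [a_s|a_s] := boolP (a \in s).
  by exists p => x; rewrite inE => /predU1P[->|]; apply: ps.
pose w := \prod_(y <- s) ('X - y%:P).
have wa : w.[a] != 0 by rewrite -/(root w a) root_prod_XsubC.
exists (p + ((phi a - p.[a]) / w.[a])%:P * w) => x.
rewrite inE !hornerE => /predU1P[->|xs].
  by rewrite divfK // addrC subrK.
have /rootP-> : root w x by rewrite root_prod_XsubC.
by rewrite mulr0 addr0 ps.
Qed.

Variable C : numClosedFieldType.

(* Averaging an interpolating polynomial with its conjugate makes it real. *)
Lemma real_poly_interpolation (s : seq C) (phi : C -> C) :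
  {in s, forall x, x^* \in s} -> {in s, forall x, phi x^* = (phi x)^*} ->
  exists2 p : {poly C}, map_poly conjC p = p & {in s, forall x, p.[x] = phi x}.
Proof.
move=> cs cphi; have [p ps] := poly_interpolation s phi.
exists (2^-1 *: (p + map_poly conjC p)).
  have pK : map_poly conjC (map_poly conjC p) = p.
    by rewrite -map_poly_comp map_poly_id // => x _; apply: conjCK.
  rewrite map_polyZ rmorphD /= pK.
  by rewrite fmorphV rmorph_nat addrC.
move=> x xs; rewrite hornerZ hornerD -{2}[x]conjCK horner_map /=.
rewrite !ps ?cs // cphi // conjCK -mulr2n -[phi x *+ 2]mulr_natl mulKf //.
by rewrite pnatr_eq0.
Qed.

End Interpolation.

Lemma rank_diag_mx (F : fieldType) n (d : 'rV[F]_n) :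
  \rank (diag_mx d) = (\sum_(i < n) (d 0 i != 0)%R)%N.
Proof.
elim: n d => [|n IHn] d; first by rewrite big_ord0 [diag_mx d]flatmx0 mxrank0.
move: d; rewrite -[n.+1]/(1 + n)%N => d.
rewrite -[d]hsubmxK diag_mx_row rank_diag_block_mx IHn.
rewrite big_split_ord /= big_ord1; congr (_ + _)%N.
  rewrite rank_rV row_mxEl; congr (~~ _ : nat).
  apply/eqP/eqP => [/matrixP/(_ 0 0)|lsub0]; first by rewrite !mxE eqxx.
  by apply/matrixP => i j; rewrite !ord1 [LHS]mxE lsub0 mul0rn mxE.
by apply: eq_bigr => i _; rewrite row_mxEr.
Qed.

(** * Eigenvalue lists of diagonalized matrices, and elementary facts on orthogonal ones *)

Section Spectrum.
Variables (C : numClosedFieldType) (m : nat).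
Implicit Types (f g h A B S M : 'M[C]_m) (d e : 'rV[C]_m).

Definition entries d : seq C := [seq d 0 i | i <- enum 'I_m].

Lemma size_entries d : size (entries d) = m.
Proof. by rewrite size_map size_enum_ord. Qed.

Lemma mem_entries d i : d 0 i \in entries d.
Proof. by apply/mapP; exists i; rewrite ?mem_enum. Qed.

Lemma entriesP d x : reflect (exists i, x = d 0 i) (x \in entries d).
Proof.
by apply: (iffP mapP) => [[i _ ->]|[i ->]]; exists i; rewrite ?mem_enum.
Qed.

Lemma count_entries d x : count_mem x (entries d) = (\sum_(i < m) (d 0 i == x)%R)%N.
Proof.
rewrite count_map -sum1_count big_mkcond /= -big_enum /=.
by apply: eq_bigr => i _; case: (_ == x).
Qed.

(** Row [i] of [S] is a left eigenvector of [f] for [d 0 i]. Keeping [S] and the order of [d]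
    explicit allows two matrices to be compared in a common eigenbasis. *)
Definition diagonalizes S d f := S \is unitarymx /\ f = invmx S *m diag_mx d *m S.

Lemma dimker_diagonalizes S d f x : diagonalizes S d f ->
  dimker (f - x%:M) = count_mem x (entries d).
Proof.
case=> /unitarymx_unit Su ->; rewrite /dimker mxrank_ker.
have -> : invmx S *m diag_mx d *m S - x%:M =
          invmx S *m (diag_mx (\row_i (d 0 i - x))) *m S.
  rewrite -[x%:M](mulmxKV Su) -scalar_mxC -mulmxBl -mulmxBr.
  congr (_ *m _ *m _); apply/matrixP=> i j; rewrite !mxE -mulrnBl.
  by case: eqP => // ->.
rewrite mxrankMfree ?row_free_unit // eqmxMfull ?row_full_unit ?unitmx_inv //.
have -> : \rank (diag_mx (\row_i (d 0 i - x))) = (\sum_(i < m) (d 0 i != x)%R)%N.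
  by rewrite rank_diag_mx; apply: eq_bigr => i _; rewrite mxE subr_eq0.
(* Adding the rank to both sides removes the subtraction: the indices with [d 0 i != x] and those
   with [d 0 i == x] together number [m]. *)
rewrite count_entries; apply: (@addnI (\sum_(i < m) (d 0 i != x)%R)%N).
rewrite -big_split /= [RHS](eq_bigr (fun=> 1%N)); last by move=> i _; case: eqP.
rewrite sum1_card card_ord.
rewrite subnKC // -[X in (_ <= X)%N]card_ord -sum1_card leq_sum // => i _.
exact: leq_b1.
Qed.

Lemma eigvals_diagonalizes S d f : diagonalizes S d f ->
  perm_eq (eigvals f) (undup (entries d)).
Proof.
move=> Sf; apply: uniq_perm; rewrite ?undup_uniq // => x.
rewrite /eigvals !mem_undup.
case: closed_field_poly_normal => r /= def_r.
have -> : (x \in r) = root (char_poly f) x.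
  rewrite def_r rootZ ?root_prod_XsubC // lead_coef_eq0 -size_poly_eq0.
  by rewrite size_char_poly.
rewrite -eigenvalue_root_char /eigenvalue -mxrank_eq0 -[\rank _]/(dimker _).
by rewrite (dimker_diagonalizes _ Sf) -has_pred1 has_count lt0n.
Qed.

Lemma segre_eq S d f S' e g : diagonalizes S d f -> diagonalizes S' e g ->
  segre f = segre g <->
  perm_eq [seq count_mem x (entries d) | x <- upper (entries d)]
          [seq count_mem x (entries e) | x <- upper (entries e)] /\
  perm_eq [seq count_mem x (entries d) | x <- signs (entries d)]
          [seq count_mem x (entries e) | x <- signs (entries e)].
Proof.
(* Sorted lists agree exactly when the unsorted ones are permutations of each other, so both
   components of the symbol become multisets. *)
have geqP := perm_sortP (fun a b => leq_total b a)
  (fun a b c ab bc => leq_trans bc ab)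
  (fun a b ab => anti_leq (etrans (andbC _ _) ab)).
have pairs S1 d1 f1 : diagonalizes S1 d1 f1 ->
    perm_eq [seq dimker (f1 - x%:M) | x <- eigvals f1 & 0 < 'Im x]
            [seq count_mem x (entries d1) | x <- upper (entries d1)].
  move=> Sf; rewrite (eq_map (fun x => dimker_diagonalizes x Sf)).
  by apply/perm_map/perm_filter/(eigvals_diagonalizes Sf).
have reals S1 d1 f1 : diagonalizes S1 d1 f1 ->
    [seq k <- [:: dimker (f1 - 1%:M); dimker (f1 + 1%:M)] | (0 < k)%N] =
    [seq count_mem x (entries d1) | x <- signs (entries d1)].
  move=> Sf; have -> : f1 + 1%:M = f1 - (-1)%:M by rewrite raddfN opprK.
  rewrite !(dimker_diagonalizes _ Sf).
  rewrite -[[:: _; _]]/[seq count_mem x (entries d1) | x <- [:: 1; -1]].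
  rewrite filter_map; congr map; apply: eq_filter => x /=.
  by rewrite -has_pred1 has_count.
move=> Sf Sg; rewrite /segre /segre_pairs /segre_real.
rewrite (reals _ _ _ Sf) (reals _ _ _ Sg).
rewrite -(permPl (pairs _ _ _ Sf)) -(permPr (pairs _ _ _ Sg)).
by split=> [[/geqP pU /geqP pR]|[/geqP pU /geqP pR]]; [split|rewrite pU pR].
Qed.

Lemma orth_unitary f : orth_mx f -> f \is unitarymx.
Proof.
case=> fr ff; apply/unitarymxP; rewrite realmxC //.
by apply/mxOverP => i j; rewrite mxE (mxOverP fr).
Qed.

Lemma orthC f : orth_mx f -> f^T *m f = 1%:M.
Proof. by case=> _ /mulmx1C. Qed.

Lemma orth_unit f : orth_mx f -> f \in unitmx.
Proof. by case=> _ /mulmx1_unit[]. Qed.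

Lemma invmx_orth f : orth_mx f -> invmx f = f^T.
Proof.
by move=> fo; rewrite -[LHS]mul1mx -(orthC fo) mulmxK ?orth_unit.
Qed.

Lemma realmx_conj A : A^conjC = A -> A \is a realmx.
Proof.
move=> Ac; apply/mxOverP => i j; apply/CrealP.
by rewrite -[in RHS]Ac mxE.
Qed.

Lemma realmx_tr A : A \is a realmx -> A^T \is a realmx.
Proof. by move=> Ar; apply/mxOverP => i j; rewrite mxE (mxOverP Ar). Qed.

Lemma realmx_inv A : A \is a realmx -> invmx A \is a realmx.
Proof. by move=> Ar; apply: realmx_conj; rewrite map_invmx /= realmxC. Qed.

Lemma comm_invmx A B : A \in unitmx -> A *m B = B *m A ->
  invmx A *m B = B *m invmx A.
Proof.
by move=> Au AB; rewrite -[B in LHS](mulmxK Au) -AB -mulmxA mulKmx.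
Qed.

Lemma orth_mul f g : orth_mx f -> orth_mx g -> orth_mx (f *m g).
Proof.
case=> fr ff [gr gg]; split; first exact: mxOverM.
by rewrite trmx_mul mulmxA -[f *m g *m _]mulmxA gg mulmx1.
Qed.

Lemma orth_tr f : orth_mx f -> orth_mx f^T.
Proof.
move=> fo; split; last by rewrite trmxK orthC.
by apply/mxOverP => i j; rewrite mxE; apply: (mxOverP fo.1).
Qed.

Lemma orth_real_unitary f : f \is a realmx -> f \is unitarymx -> orth_mx f.
Proof.
move=> fr /unitarymxP; rewrite realmxC //.
by apply/mxOverP => i j; rewrite mxE (mxOverP fr).
Qed.

Lemma orth_diagonalizes f : orth_mx f -> exists S d, diagonalizes S d f.
Proof.
move=> fo; exists (spectralmx f), (spectral_diag f).
split; first exact: spectral_unitarymx.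
apply/orthomx_spectralP/normalmxP.
by have /unitarymxP fU := orth_unitary fo; rewrite fU (mulmx1C fU).
Qed.

Lemma diagonalizes_conj S d f A : A \is unitarymx -> diagonalizes S d f ->
  diagonalizes (S *m invmx A) d (A *m f *m invmx A).
Proof.
move=> AU [SU ->]; have AU' : invmx A \is unitarymx.
  by rewrite invmx_unitary // trmxC_unitary.
have SAU : S *m invmx A \is unitarymx by rewrite mul_unitarymx.
split=> //; rewrite [invmx (S *m _)]invmx_unitary // trmx_mul map_mxM /=.
by rewrite -!invmx_unitary // invmxK !mulmxA.
Qed.

Lemma diagonalizes_inj S d f g : diagonalizes S d f -> diagonalizes S d g -> f = g.
Proof. by move=> [_ ->] [_ ->]. Qed.

Lemma diag_unitary S d f : diagonalizes S d f ->
  (f \is unitarymx) <-> (forall i, d 0 i * (d 0 i)^* = 1).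
Proof.
move=> [SU def_f].
have SU' : S^t* \is unitarymx by rewrite trmxC_unitary.
have -> : f \is unitarymx = (diag_mx d \is unitarymx).
  apply/idP/idP => [fU|dU].
    have -> : diag_mx d = S *m f *m S^t*.
      rewrite def_f invmx_unitary // !mulmxA (unitarymxP SU) mul1mx.
      by rewrite -mulmxA (unitarymxP SU) mulmx1.
    by rewrite !mul_unitarymx.
  by rewrite def_f invmx_unitary // !mul_unitarymx.
split=> [/unitarymxP dd i|dd].
  have /matrixP/(_ i i) := dd.
  by rewrite mul_diag_mx !mxE eqxx !mulr1n.
apply/unitarymxP/matrixP => i j; rewrite mul_diag_mx !mxE eq_sym.
case: eqP => [->|_]; last by rewrite mulr0n rmorph0 mulr0.
by rewrite !mulr1n dd.
Qed.

Lemma orth_entries_norm1 S d f : orth_mx f -> diagonalizes S d f ->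
  {in entries d, forall x, x * x^* = 1}.
Proof.
move=> /orth_unitary fU /diag_unitary dU _ /entriesP[i ->].
exact: (proj1 dU fU).
Qed.

(** For real [f], conjugating entries turns [f - x%:M] into [f - x^*%:M], and a field morphism
    preserves rank. *)
Lemma count_entries_conj S d f : f \is a realmx -> diagonalizes S d f ->
  forall x, count_mem x^* (entries d) = count_mem x (entries d).
Proof.
move=> fr Sf x; rewrite -!(dimker_diagonalizes _ Sf) /dimker !mxrank_ker.
rewrite -(mxrank_map conjC (f - x%:M)).
by rewrite map_mxB map_scalar_mx realmxC.
Qed.

Lemma entries_conj S d f : f \is a realmx -> diagonalizes S d f ->
  {in entries d, forall x, x^* \in entries d}.
Proof.
move=> fr Sf x; rewrite -!has_pred1 !has_count.
by rewrite (count_entries_conj fr Sf).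
Qed.

Lemma segre_matching S d f S' e g : orth_mx f -> orth_mx g ->
  diagonalizes S d f -> diagonalizes S' e g ->
  segre f = segre g <->
  exists phi, spectral_matching (entries d) (entries e) phi.
Proof.
move=> fo go Sf Sg; apply: (iff_trans (segre_eq Sf Sg)).
have cd := count_entries_conj fo.1 Sf; have ce := count_entries_conj go.1 Sg.
have nd := orth_entries_norm1 fo Sf; have ne := orth_entries_norm1 go Sg.
split=> [[permU permR]|[phi]].
  by apply: matching_of_counts => //; rewrite !size_entries.
exact: counts_of_matching.
Qed.

Lemma conj_unitmx_inj S A B : S \in unitmx ->
  invmx S *m A *m S = invmx S *m B *m S -> A = B.
Proof.
move=> Su /(can_inj (mulmxK Su)) eqXY.
by rewrite -[A](mulKVmx Su) eqXY mulKVmx.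
Qed.

(** In an eigenbasis of [f], the commutant consists of the matrices whose entries vanish between
    different eigenvalues. *)
Lemma comm_diagonalizes S d f A (B := S *m A *m invmx S) : diagonalizes S d f ->
  A *m f = f *m A <-> (forall i j, d 0 i * B i j = B i j * d 0 j).
Proof.
move=> [/unitarymx_unit Su ->].
have defA : A = invmx S *m B *m S by rewrite /B !mulmxA mulVmx // mul1mx mulmxKV.
clearbody B; rewrite {A}defA.
rewrite !mulmxA !mulmxK // -(mulmxA (invmx S) B) -(mulmxA (invmx S) (diag_mx d)).
split=> [|eqB].
  move/(conj_unitmx_inj Su)/matrixP => eqB i j.
  by have := eqB i j; rewrite mul_diag_mx mul_mx_diag !mxE.
congr (_ *m _ *m _); apply/matrixP => i j.
by rewrite mul_diag_mx mul_mx_diag !mxE.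
Qed.

End Spectrum.

(** * From a matching to conjugate centralizers *)

Section OrthogonalSimilarity.
Variables (C : numClosedFieldType) (n : nat).
Local Notation m := n.+1.
Implicit Types (f g h A B S M : 'M[C]_m) (d e : 'rV[C]_m).

Lemma diagonalizes_horner S d f (p : {poly C}) : diagonalizes S d f ->
  diagonalizes S (\row_i p.[d 0 i]) (horner_mx f p).
Proof.
move=> [SU ->]; split=> //; rewrite horner_mx_uconjC ?unitarymx_unit //.
rewrite horner_mx_diag; congr (_ *m diag_mx _ *m _).
by apply/rowP => i; rewrite !mxE.
Qed.

Lemma real_horner f (p : {poly C}) : f \is a realmx -> map_poly conjC p = p ->
  horner_mx f p \is a realmx.
Proof.
by move=> fr pr; apply: realmx_conj; rewrite map_horner_mx pr realmxC.
Qed.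

Lemma trmx_horner f (p : {poly C}) : (horner_mx f p)^T = horner_mx f^T p.
Proof.
elim/poly_ind: p => [|p c IHp]; first by rewrite !rmorph0 trmx0.
rewrite !rmorphD !rmorphM /= !horner_mx_X !horner_mx_C linearD /= tr_scalar_mx.
rewrite -[_ * f]/(_ *m f) trmx_mul IHp; congr (_ + _).
exact/comm_mx_horner.
Qed.

(* The orthogonal matrix is the factor X (X^T X)^(-1/2) of the polar
   decomposition of X; X^T X commutes with A because A and B are orthogonal. *)
Lemma orth_of_real_similar A B (X : 'M[C]_m) : orth_mx A -> orth_mx B ->
  X \is a realmx -> X \in unitmx -> X *m A = B *m X ->
  exists2 k, orth_mx k & k *m A = B *m k.
Proof.
move=> Ao Bo Xr Xu XA.
have XB : X^T *m B = A *m X^T.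
  (* Transpose the intertwining relation, then cancel the orthogonal factors. *)
  have tXA : A^T *m X^T = X^T *m B^T by rewrite -!trmx_mul XA.
  by rewrite -[X^T in LHS]mul1mx -Ao.2 -!mulmxA (mulmxA A^T) tXA -mulmxA
             (orthC Bo) mulmx1.
pose M := X^T *m X.
have MA : M *m A = A *m M by rewrite /M -mulmxA XA mulmxA XB mulmxA.
have Mr : M \is a realmx by rewrite mxOverM ?realmx_tr.
have Mt : M^T = M by rewrite trmx_mul trmxK.
have Mu : M \in unitmx by rewrite unitmx_mul unitmx_tr Xu.
pose S := spectralmx M; pose d := spectral_diag M.
have SU : S \is unitarymx by apply: spectral_unitarymx.
have SM : diagonalizes S d M.
  by split=> //; apply/orthomx_spectralP/normalmxP; rewrite Mt realmxC.
(* [M] is a Gram matrix: its eigenvalues are the squared norms of the rows of [S *m X^T]. *)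
have d_ge0 i : 0 <= d 0 i.
  pose Y := S *m X^T.
  have dY : diag_mx d = Y *m Y^t*.
    rewrite /Y trmx_mul trmxK map_mxM /= [X^conjC]realmxC // mulmxA.
    rewrite -[S *m _ *m _]mulmxA -/M SM.2 -invmx_unitary // !mulmxA.
    by rewrite mulmxV ?mul1mx ?mulmxK ?unitarymx_unit.
  have /matrixP/(_ i i) := dY; rewrite !mxE eqxx mulr1n => ->.
  by apply: sumr_ge0 => j _; rewrite !mxE -normCK exprn_ge0.
(* As a real polynomial in [M], the square root [P] below is real, symmetric and commutes with
   [A]. *)
have [||p pr ps] := @real_poly_interpolation C (entries d) sqrtC.
- by move=> x /(entries_conj Mr SM).
- move=> _ /entriesP[i ->]; have d_real : d 0 i \is Num.real := ger0_real (d_ge0 i).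
  rewrite (CrealP d_real); apply/esym/CrealP/ger0_real.
  by rewrite sqrtC_ge0.
pose P := horner_mx M p.
have PP : P *m P = M.
  apply: (diagonalizes_inj (S := S) (d := d)) => //.
  rewrite -[P *m P]/(P * P) -rmorphM.
  suff -> : d = \row_i (p * p).[d 0 i] by apply: diagonalizes_horner.
  by apply/rowP => i; rewrite mxE hornerM ps ?mem_entries // -expr2 sqrtCK.
have Pu : P \in unitmx by move: Mu; rewrite -PP unitmx_mul => /andP[].
have PA : P *m A = A *m P by apply: comm_horner_mx.
have Pt : P^T = P by rewrite trmx_horner Mt.
exists (X *m invmx P); last first.
  by rewrite -mulmxA comm_invmx // mulmxA XA mulmxA.
split; first by rewrite mxOverM ?realmx_inv // real_horner.
apply: mulmx1C; rewrite trmx_mul trmx_inv Pt mulmxA -[_ *m X^T *m X]mulmxA.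
by rewrite -/M -PP mulmxA mulVmx // mul1mx mulmxV.
Qed.

Lemma orth_similar S d f S' e g : orth_mx f -> orth_mx g ->
  diagonalizes S d f -> diagonalizes S' e g ->
  perm_eq (entries d) (entries e) ->
  exists2 k, orth_mx k & k *m f = g *m k.
Proof.
move=> fo go Sf Sg; rewrite perm_sym => perm_ed.
have [s def_e] : exists s : 'S_m, forall i, e 0 i = d 0 (s i).
  pose t := [tuple d 0 i | i < m].
  have /tuple_permP[s eq_et] : perm_eq (entries e) t by [].
  exists s => i; have := congr1 (nth 0 ^~ i) eq_et.
  rewrite (nth_map i) ?size_enum_ord // nth_ord_enum => ->.
  by rewrite (nth_map i) ?size_enum_ord // nth_ord_enum tnth_mktuple.
have PD : perm_mx s *m diag_mx d = diag_mx e *m perm_mx s :> 'M[C]_m.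
  rewrite -row_permE mul_diag_mx; apply/matrixP=> i j; rewrite !mxE def_e.
  by rewrite -mulr_natr eq_sym; case: eqP => // ->.
have [SU _] := Sf; have [SU' def_g] := Sg.
have [Su Su'] := (unitarymx_unit SU, unitarymx_unit SU').
have [X] : exists2 X, X \in [predI realmx & unitmx] & similar X f g.
  apply: real_similar; [|exact: fo.1|exact: go.1].
  (* A complex similarity, obtained by matching the eigenvectors of [f] and [g] along [s];
     [real_similar] makes it real. *)
  pose X := invmx S' *m perm_mx s *m S.
  have Xu : X \in unitmx by rewrite !unitmx_mul unitmx_inv Su Su' unitmx_perm.
  exists X => //; apply/(similarP Xu).
  rewrite Sf.2 def_g /X !mulmxA !mulmxK //.
  by rewrite -[_ *m perm_mx s *m diag_mx d]mulmxA PD !mulmxA.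
rewrite inE => /andP[Xr Xu] /(similarP Xu).
exact: orth_of_real_similar.
Qed.

(** The centralizer of [f] depends only on its commutant, so [f] can be replaced by [f'], whose
    centralizer [k] carries to that of [g]. *)
Lemma conjugate_centralizers f f' g k :
  (forall h, h *m f = f *m h <-> h *m f' = f' *m h) ->
  orth_mx k -> k *m f' = g *m k ->
  conjugate_in_O (centralizer_O f) (centralizer_O g).
Proof.
move=> ff' ko kf'; have ku := orth_unit ko.
have kVo : orth_mx (invmx k) by rewrite invmx_orth //; apply: orth_tr.
have def_g : g = k *m f' *m invmx k by rewrite kf' mulmxK.
exists k; split=> // h; split=> [[ho hg]|[h0 [h0o /ff' h0f] ->]]; last first.
  split; first by apply: orth_mul => //; apply: orth_mul.
  by rewrite def_g !mulmxA !mulmxKV // -!(mulmxA k) h0f.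
exists (invmx k *m h *m k); last by rewrite !mulmxA mulmxV // mul1mx mulmxK.
split; first by apply: orth_mul => //; apply: orth_mul.
apply/ff'; have f'V : f' *m invmx k = invmx k *m g.
  by rewrite def_g !mulmxA mulVmx // mul1mx.
by rewrite -[_ *m k *m f']mulmxA kf' !mulmxA f'V -(mulmxA _ h g) hg !mulmxA.
Qed.

Lemma conjugate_of_matching S d f S' e g phi : orth_mx f -> orth_mx g ->
  diagonalizes S d f -> diagonalizes S' e g ->
  spectral_matching (entries d) (entries e) phi ->
  conjugate_in_O (centralizer_O f) (centralizer_O g).
Proof.
move=> fo go Sf Sg [inj cj perm_phi].
have [p pr ps] := real_poly_interpolation (entries_conj fo.1 Sf) cj.
pose f' := horner_mx f p; have Sf' := diagonalizes_horner p Sf; rewrite -/f' in Sf'.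
set d' := \row_i _ in Sf'.
have def_d' : entries d' = map phi (entries d).
  rewrite /entries -map_comp; apply: eq_map => i /=.
  by rewrite mxE ps ?mem_entries.
(* [f'] is real because [p] is, and unitary because its eigenvalues are eigenvalues of [g]. *)
have f'o : orth_mx f'.
  apply: orth_real_unitary; first exact: real_horner fo.1 pr.
  apply/(diag_unitary Sf') => i; apply: (orth_entries_norm1 go Sg).
  by rewrite -(perm_mem perm_phi) -def_d' mem_entries.
have [k ko kf'] : exists2 k, orth_mx k & k *m f' = g *m k.
  by apply: orth_similar Sf' Sg _; rewrite // def_d'.
apply: conjugate_centralizers ko kf' => h; split=> [hf|hf'].
  exact: comm_mx_horner.
(* [psi] inverts [phi] on the spectrum, where the default [0] is never reached. Interpolating it
   recovers [f] as a polynomial in [f'], so nothing new commutes with [f']. *)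
pose psi y := nth 0 (entries d) (index y (map phi (entries d))).
have [q qs] := poly_interpolation (entries d') psi.
suff -> : f = horner_mx f' q by apply: comm_mx_horner.
apply: (diagonalizes_inj Sf).
suff -> : d = \row_i q.[d' 0 i] by apply: diagonalizes_horner.
apply/rowP => i; rewrite mxE qs ?mem_entries // /psi mxE ps ?mem_entries //.
set x := d 0 i; have xd : x \in entries d by apply: mem_entries.
have ix : (index (phi x) (map phi (entries d)) < size (entries d))%N.
  by rewrite -(size_map phi) index_mem map_f.
apply: inj; rewrite ?mem_nth //.
by rewrite -(nth_map 0 0 phi) // nth_index // map_f.
Qed.

End OrthogonalSimilarity.

(** * From conjugate centralizers to a matching *)

Section Commutant.
Variables (C : numClosedFieldType) (n : nat).
Local Notation m := n.+1.
Implicit Types (f g h A B S M : 'M[C]_m) (d e : 'rV[C]_m).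

(** * An inclusion of orthogonal centralizers extends to the full complex commutants *)

Section OrthogonalCentralizer.
Variables f g : 'M[C]_m.
Hypothesis go : orth_mx g.
Hypothesis cfg : forall h, orth_mx h -> h *m g = g *m h -> h *m f = f *m h.

(* A symmetric matrix is a combination of the reflections in its eigenspaces,
   which are real polynomials in it. *)
Lemma comm_symmetric M : M \is a realmx -> M^T = M ->
  M *m g = g *m M -> M *m f = f *m M.
Proof.
move=> Mr Mt Mg; pose S := spectralmx M; pose d := spectral_diag M.
have SU : S \is unitarymx by apply: spectral_unitarymx.
have SM : diagonalizes S d M.
  by split=> //; apply/orthomx_spectralP/normalmxP; rewrite Mt realmxC.
have d_real i : (d 0 i)^* = d 0 i.
  apply/CrealP/(mxOverP (hermitian_spectral_diag_real _)).
  by apply/is_hermitianmxP; rewrite expr0 scale1r Mt realmxC.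
apply/esym/(comm_diagonalizes f SM) => i j.
set F := S *m f *m invmx S.
have [-> | neq_ij] := eqVneq (d 0 j) (d 0 i); first exact: mulrC.
(* The interpolating [p] makes [Q] the reflection negating the eigenspace of [M] for [d 0 i];
   commuting with it forces [F i j = - F i j]. *)
pose phi x : C := if x == d 0 i then -1 else 1.
have [||p pr ps] := @real_poly_interpolation C (entries d) phi.
- by move=> x /(entries_conj Mr SM).
- move=> _ /entriesP[k ->]; rewrite d_real /phi.
  by case: ifP; rewrite ?rmorphN rmorph1.
have SQ := diagonalizes_horner p SM; set Q := horner_mx M p in SQ.
have Qo : orth_mx Q.
  apply: orth_real_unitary; first exact: real_horner.
  apply/(diag_unitary SQ) => k; rewrite mxE ps ?mem_entries // /phi.
  by case: ifP; rewrite ?rmorphN rmorph1 ?mulrNN mulr1.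
have /esym/(comm_diagonalizes f SQ)/(_ i j) : Q *m f = f *m Q.
  by apply: cfg => //; apply: comm_horner_mx.
rewrite -/F !mxE !ps ?mem_entries // /phi eqxx (negPf neq_ij) mulN1r mulr1.
move/eqP; rewrite eq_sym -subr_eq0 opprK -mulr2n mulrn_eq0 /= => /eqP->.
by rewrite mulr0 mul0r.
Qed.

(** If [v *m K = v], moving [K] across the Hermitian form changes its sign, so the squared norm of
    [v] equals its own opposite and [v = 0]. *)
Lemma unit_1_sub_antisymmetric (K : 'M[C]_m) : K \is a realmx -> K^T = - K ->
  1%:M - K \in unitmx.
Proof.
move=> Kr Kt; rewrite -row_free_unit -kermx_eq0; apply/rowV0P => v /sub_kermxP.
rewrite mulmxBr mulmx1 => /eqP; rewrite subr_eq0 => /eqP vK.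
apply/eqP/contraT => /dotmx_is_dotmx; rewrite dotmxE.
suff -> : v *m v^t* = 0 by rewrite mxE ltxx.
have : (v *m K)^t* = - (K *m v^t*).
  by rewrite trmx_mul map_mxM /= Kt map_mxN /= realmxC // mulNmx.
rewrite -vK => /(congr1 (mulmx v)); rewrite mulmxN mulmxA -vK => /eqP.
rewrite -addr_eq0 -mulr2n -scaler_nat scaler_eq0 pnatr_eq0 /= => /eqP.
exact.
Qed.

(* The Cayley transform (1 + K) (1 - K)^-1 is orthogonal and determines K. *)
Lemma comm_antisymmetric M : M \is a realmx -> M^T = - M ->
  M *m g = g *m M -> M *m f = f *m M.
Proof.
move=> Mr Mt Mg; pose U := 1%:M - M.
have Uu : U \in unitmx by apply: unit_1_sub_antisymmetric.
have Ut : U^T = 1%:M + M by rewrite linearB /= trmx1 Mt opprK.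
have Ur : U \is a realmx.
  by apply: realmx_conj; rewrite map_mxB map_mx1 realmxC.
have UtU : U^T *m U = U *m U^T.
  have MU : M *m U = U *m M by rewrite mulmxBl mulmxBr mul1mx mulmx1.
  by rewrite Ut mulmxDl mulmxDr mul1mx mulmx1 MU.
have Ug : U *m g = g *m U by rewrite mulmxBl mulmxBr mul1mx mulmx1 Mg.
pose O := U^T *m invmx U.
have Oo : orth_mx O.
  split; first by rewrite mxOverM ?realmx_tr ?realmx_inv.
  apply: mulmx1C; rewrite trmx_mul trmxK trmx_inv mulmxA -(mulmxA (invmx _)).
  by rewrite -UtU mulmxA mulVmx ?unitmx_tr // mul1mx mulmxV.
have Of : O *m f = f *m O.
  apply: cfg => //; rewrite /O -mulmxA comm_invmx // !mulmxA; congr (_ *m _).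
  by rewrite Ut mulmxDl mulmxDr mul1mx mulmx1 Mg.
(* Since [U^T + U] is twice the identity, [O + 1%:M] is [2 *: invmx U]; this inverts the Cayley
   transform. *)
have def_U : invmx U = 2^-1 *: (O + 1%:M).
  have UtDU : U^T + U = 2 *: 1%:M.
    by rewrite Ut addrACA subrr addr0 scaler_nat mulr2n.
  rewrite -(mulmxV Uu) -mulmxDl UtDU -scalemxAl mul1mx scalerK //.
  by rewrite pnatr_eq0.
have Uf : U *m f = f *m U.
  rewrite -[U]invmxK; apply: comm_invmx; first by rewrite unitmx_inv.
  by rewrite def_U -scalemxAl -scalemxAr mulmxDl mulmxDr Of mul1mx mulmx1.
have -> : M = 1%:M - U by rewrite /U opprB addrC subrK.
by rewrite mulmxBl mulmxBr mul1mx mulmx1 Uf.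
Qed.

(** The commutant of the orthogonal [g] is closed under transposition, since [g^T] is the inverse of
    [g]; hence it contains the symmetric and antisymmetric parts of [M]. *)
Lemma comm_real M : M \is a realmx -> M *m g = g *m M -> M *m f = f *m M.
Proof.
move=> Mr Mg; have Mtr := realmx_tr Mr.
have Mtg : M^T *m g = g *m M^T.
  have tMg : g^T *m M^T = M^T *m g^T by rewrite -!trmx_mul Mg.
  by rewrite -[M^T in LHS]mul1mx -go.2 -!mulmxA (mulmxA g^T) tMg -mulmxA
             (orthC go) mulmx1.
have Mf1 : (M + M^T) *m f = f *m (M + M^T).
  apply: comm_symmetric; first exact: realmxD.
    by rewrite linearD /= trmxK addrC.
  by rewrite mulmxDl mulmxDr Mg Mtg.
have Mf2 : (M - M^T) *m f = f *m (M - M^T).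
  apply: comm_antisymmetric.
  - by apply: realmx_conj; rewrite map_mxB !realmxC.
  - by rewrite linearB /= trmxK opprB.
  - by rewrite mulmxBl mulmxBr Mg Mtg.
have -> : M = 2^-1 *: ((M + M^T) + (M - M^T)).
  rewrite addrACA subrr addr0 -mulr2n -scaler_nat scalerA mulVf ?scale1r //.
  by rewrite pnatr_eq0.
by rewrite -scalemxAl -scalemxAr mulmxDl [in RHS]mulmxDr Mf1 Mf2.
Qed.

(** As [g] is real, [Mc] also commutes with it, and [M + Mc] and ['i *: (M - Mc)] are real. *)
Lemma comm_commutant M : M *m g = g *m M -> M *m f = f *m M.
Proof.
move=> Mg; have gr := go.1; pose Mc := map_mx conjC M.
have Mcg : Mc *m g = g *m Mc.
  by rewrite -[g](realmxC gr) -!map_mxM Mg.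
have cK : map_mx conjC Mc = M by apply/matrixP => i j; rewrite !mxE conjCK.
have Mf1 : (M + Mc) *m f = f *m (M + Mc).
  apply: comm_real; last by rewrite mulmxDl mulmxDr Mg Mcg.
  by apply: realmx_conj; rewrite map_mxD /= cK addrC.
have Mf2 : (M - Mc) *m f = f *m (M - Mc).
  have : ('i *: (M - Mc)) *m f = f *m ('i *: (M - Mc)).
    apply: comm_real; last first.
      by rewrite -scalemxAl -scalemxAr mulmxBl mulmxBr Mg Mcg.
    apply: realmx_conj; rewrite map_mxZ map_mxB /= cK /= conjCi.
    by rewrite scaleNr -scalerN opprB.
  rewrite -scalemxAl -scalemxAr => /(congr1 (fun X => 'i^-1 *: X)).
  by rewrite !scalerK ?neq0Ci.
have -> : M = 2^-1 *: ((M + Mc) + (M - Mc)).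
  rewrite addrACA subrr addr0 -mulr2n -scaler_nat scalerA mulVf ?scale1r //.
  by rewrite pnatr_eq0.
by rewrite -scalemxAl -scalemxAr mulmxDl [in RHS]mulmxDr Mf1 Mf2.
Qed.

End OrthogonalCentralizer.

(** In the eigenbasis of [g], the matrix units joining equal eigenvalues commute with [g], hence
    with [f]. The diagonal units make [f] diagonal, the others equate its diagonal entries. *)
Lemma diagonalizes_of_commutant S d f g : diagonalizes S d g ->
  (forall M, M *m g = g *m M -> M *m f = f *m M) ->
  exists2 e, diagonalizes S e f & forall i j, d 0 i = d 0 j -> e 0 i = e 0 j.
Proof.
move=> Sg cfg; have [SU _] := Sg; have Su := unitarymx_unit SU.
pose F := S *m f *m invmx S.
have comm_delta i j : d 0 i = d 0 j -> delta_mx i j *m F = F *m delta_mx i j.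
  move=> eq_dij; pose E := invmx S *m delta_mx i j *m S.
  have SE : S *m E *m invmx S = delta_mx i j.
    by rewrite /E !mulmxA mulmxV // mul1mx mulmxK.
  have Ef : E *m f = f *m E.
    apply: cfg; apply/(comm_diagonalizes E Sg) => a b; rewrite SE mxE.
    have [->|_] := eqVneq a i; last by rewrite mulr0 mul0r.
    have [->|_] := eqVneq b j; last by rewrite mulr0 mul0r.
    by rewrite eq_dij mulrC.
  clearbody E; rewrite -SE /F !mulmxA; congr (_ *m _).
  by rewrite !mulmxKV // -(mulmxA S E) Ef !mulmxA.
have deltaF i j a b : d 0 i = d 0 j -> F j b *+ (a == i) = F a i *+ (b == j).
  move=> /comm_delta/matrixP/(_ a b); rewrite [LHS]mxE [RHS]mxE.
  rewrite (bigD1 j) //= big1 => [|k kj]; last first.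
    by rewrite mxE (negPf kj) andbF mul0r.
  rewrite (bigD1 i) //= big1 => [|k ki]; last first.
    by rewrite [delta_mx _ _ _ _]mxE (negPf ki) mulr0.
  rewrite !addr0 ![delta_mx _ _ _ _]mxE !eqxx andbT /=.
  by rewrite mulr_natl mulr_natr.
exists (\row_i F i i) => [|i j eq_dij]; last first.
  have eqF := deltaF i j i j eq_dij; rewrite !eqxx !mulr1n in eqF.
  by rewrite [LHS]mxE [RHS]mxE eqF.
split=> //.
suff -> : diag_mx (\row_i F i i) = F.
  by rewrite /F !mulmxA mulVmx // mul1mx mulmxKV.
apply/matrixP => a b; rewrite [LHS]mxE [X in X *+ _]mxE.
(* The diagonal unit at [a] kills the rest of row [a] of [F]. *)
have := deltaF a a a b erefl; rewrite eqxx mulr1n eq_sym => ->.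
by case: eqP => // ->.
Qed.

Lemma matching_of_commutants S d e f g : f \is a realmx -> g \is a realmx ->
  diagonalizes S d f -> diagonalizes S e g ->
  (forall i j, d 0 i = d 0 j <-> e 0 i = e 0 j) ->
  exists phi, spectral_matching (entries d) (entries e) phi.
Proof.
move=> fr gr Sf Sg eq_de.
(* The choice of [i] does not matter, by [eq_de]; the default [0] is only taken off the spectrum. *)
pose phi x := if [pick i | d 0 i == x] is Some i then e 0 i else 0.
have phid i : phi (d 0 i) = e 0 i.
  rewrite /phi; case: pickP => [j /eqP/eq_de //|/(_ i)].
  by rewrite eqxx.
have [p ps] := poly_interpolation (entries d) phi.
have def_g : g = horner_mx f p.
  apply: (diagonalizes_inj Sg).
  suff -> : e = \row_i p.[d 0 i] by apply: diagonalizes_horner.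
  by apply/rowP => i; rewrite mxE ps ?mem_entries.
exists phi; split.
- by move=> _ _ /entriesP[i ->] /entriesP[j ->]; rewrite !phid => /eq_de.
- move=> x xd; have xcd := entries_conj fr Sf xd.
  (* Both [f] and [g] are real, so the conjugate of [p] also sends [f] to [g]; its value at [x^*] is
     then both [phi x^*] and [(phi x)^*]. *)
  have def_gc : g = horner_mx f (map_poly conjC p).
    by rewrite -[g](realmxC gr) def_g map_horner_mx realmxC.
  have [i def_x] := entriesP _ _ xcd; rewrite def_x.
  have SU := Sg.1; have Su := unitarymx_unit SU.
  have := diagonalizes_horner (map_poly conjC p) Sf; rewrite -def_gc => -[_].
  rewrite Sg.2 => /(conj_unitmx_inj Su)/matrixP/(_ i i).
  rewrite !mxE eqxx !mulr1n phid => ->.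
  by rewrite -def_x horner_map /= ps.
- suff -> : map phi (entries d) = entries e by [].
  by rewrite /entries -map_comp; apply: eq_map => i /=.
Qed.

Lemma matching_of_conjugate S d f S' e g : orth_mx f -> orth_mx g ->
  diagonalizes S d f -> diagonalizes S' e g ->
  conjugate_in_O (centralizer_O f) (centralizer_O g) ->
  exists phi, spectral_matching (entries d) (entries e) phi.
Proof.
move=> fo go Sf Sg [k [ko conj_fg]].
have ku := orth_unit ko.
pose f1 := k *m f *m invmx k.
have kVo : orth_mx (invmx k) by rewrite invmx_orth //; apply: orth_tr.
have f1o : orth_mx f1 by apply: orth_mul => //; apply: orth_mul.
have Sf1 := diagonalizes_conj (orth_unitary ko) Sf; rewrite -/f1 in Sf1.
set S1 := S *m invmx k in Sf1.
have cfg h : orth_mx h -> h *m g = g *m h <-> h *m f1 = f1 *m h.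
  move=> ho; split=> [hg|hf1].
    have [h0 [_ h0f] ->] : exists2 h0, centralizer_O f h0 & h = k *m h0 *m invmx k.
      by apply/conj_fg.
    by rewrite /f1 !mulmxA !mulmxKV // -!(mulmxA k) h0f.
  suff [] : centralizer_O g h by [].
  apply/conj_fg; exists (invmx k *m h *m k); last first.
    by rewrite !mulmxA mulmxV // mul1mx mulmxK.
  split; first by apply: orth_mul => //; apply: orth_mul.
  have kf : k *m f = f1 *m k by rewrite /f1 mulmxKV.
  have fk : f *m invmx k = invmx k *m f1 by rewrite /f1 !mulmxA mulVmx // mul1mx.
  clearbody f1; rewrite -[_ *m k *m f]mulmxA kf !mulmxA fk.
  by rewrite -(mulmxA _ h f1) hf1 !mulmxA.
have cf1 M : M *m g = g *m M -> M *m f1 = f1 *m M.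
  exact: (comm_commutant go (fun h ho => proj1 (cfg h ho))).
have cg M : M *m f1 = f1 *m M -> M *m g = g *m M.
  exact: (comm_commutant f1o (fun h ho => proj2 (cfg h ho))).
(* The two inclusions of commutants give a common eigenbasis [S1] and both directions of the
   coincidence condition on eigenvalues. *)
have [e1 S1g de1] := diagonalizes_of_commutant Sf1 cg.
have [d1 S1f1 e1d] := diagonalizes_of_commutant S1g cf1.
have def_d1 : d1 = d.
  have S1u := unitarymx_unit Sf1.1.
  have [_] := S1f1; rewrite Sf1.2 => /(conj_unitmx_inj S1u)/matrixP eq_d.
  apply/rowP => i.
  by have := eq_d i i; rewrite !mxE eqxx !mulr1n.
rewrite def_d1 in e1d.
have [phi [inj cj perm_phi]] : exists phi, spectral_matching (entries d) (entries e1) phi.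
  by apply: matching_of_commutants f1o.1 go.1 Sf1 S1g _ => i j; split; auto.
(* [e1] and [e] list the eigenvalues of the same [g], so their multiplicities agree as kernel
   dimensions. *)
exists phi; split=> //; apply: (perm_trans perm_phi); apply: perm_eq_count_in.
  by rewrite !size_entries.
by move=> x _; rewrite -(dimker_diagonalizes x S1g) -(dimker_diagonalizes x Sg).
Qed.

End Commutant.

Unset Implicit Arguments.
Theorem mainTheorem1 (C : numClosedFieldType) (n : nat) (hn : (1 <= n)%N)
  (f g : 'M[C]_n.+1) (hf : orth_mx f) (hg : orth_mx g) :
  segre f = segre g <-> conjugate_in_O (centralizer_O f) (centralizer_O g).
Proof.
have [S [d Sf]] := orth_diagonalizes hf; have [S' [e Sg]] := orth_diagonalizes hg.
apply: (iff_trans (segre_matching hf hg Sf Sg)); split=> [[phi]|].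
  exact: (conjugate_of_matching hf hg Sf Sg).
exact: (matching_of_conjugate hf hg Sf Sg).
Qed.
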